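(* Let $\mathbb{F}$ be a field, let $\alpha\in\mathbb{F}\setminus\{0,1,2,3\}$ be such that $2\alpha\neq 3$, and let $V$ be a non-zero vector space over $\mathbb{F}$. Then $\alpha\,\mathrm{id}_V$ is not the sum of three idempotent endomorphisms of $V$.
   Context: $\mathbb{F}$ is an arbitrary field (of any characteristic); the integers $0,1,2,3$ are viewed as elements of $\mathbb{F}$. An endomorphism $p$ of $V$ is idempotent if $p^2=p$. *)

(* Defs.v *)
From HB Require Import structures.
From mathcomp Require Export all_boot all_order all_algebra.

Set Implicit Arguments.
Unset Strict Implicit.
Unset Printing Implicit Defensive.

(* Main.v *)
(* Write [a = 2 alpha - 2] and [b = alpha^2 - alpha]. Squaring
   [r = alpha - p - q] gives [pq + qp = a (p + q) - b]. Multiplying this by [p]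
   on either side and subtracting yields [(2 alpha - 3) (pq - qp) = 0], so [p]
   and [q] commute; multiplying [2 pq = a (p + q) - b] by [p] then gives
   [(2 - alpha) (2 pq - (alpha - 1) p) = 0]. By symmetry
   [(alpha - 1) p = 2 pq = (alpha - 1) q], whence [p = q] and
   [(alpha - 3) p = 0]. So [p = 0] and likewise [q = 0], [r = 0], which
   contradicts [alpha != 0]. *)
Require Import Defs.
From mathcomp Require Import all_boot all_order all_algebra.
From mathcomp Require Import ring.

Set Implicit Arguments.
Unset Strict Implicit.
Unset Printing Implicit Defensive.

Import GRing.Theory.
Local Open Scope ring_scope.

Lemma idempotent_anticommutator (F : fieldType) (alpha : F) (V : lmodType F)
    (p q r : {linear V -> V}) :
    idempotent_fun p -> idempotent_fun q -> idempotent_fun r ->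
    p \+ q \+ r =1 alpha \*: idfun ->
  forall v, p (q v) + q (p v)
    = (2%:R * alpha - 2%:R) *: (p v + q v) - (alpha ^+ 2 - alpha) *: v.
Proof.
move=> pp qq rr pqr v.
have rE w : r w = alpha *: w - (p w + q w).
  by rewrite -[alpha *: w]/((alpha \*: idfun) w) -pqr /= addrC addKr.
(* With [s = p + q], idempotence gives [s^2 = s + (pq + qp)]; this is how the anticommutator enters
   [r^2 = r]. *)
have ss : p (p v + q v) + q (p v + q v)
    = (p v + q v) + (p (q v) + q (p v)).
  by rewrite !linearD -[p (p v)]/((p \o p) v) -[q (q v)]/((q \o q) v) pp qq
     [q (p v) + _]addrC addrACA.
have := rr v; rewrite /= (rE (r v)) rE (linearB p) (linearB q) /=.
rewrite (linearZ_LR p) (linearZ_LR q) addrACA -opprD -scalerDr ss.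
move: (p v + q v) (p (q v) + q (p v)) => s t; rewrite scalerBr.
rewrite !scalerBl expr2 -!scalerA !scaler_nat.
set B := alpha *: s; set C := alpha *: v; set A := alpha *: _ => e.
have {e} st : s + t = C - s - (A - B) + B.
  by rewrite -e [A - B + _]addrC addrK opprB subrK.
rewrite -[t](addKr s) st !opprB !mulr2n !opprD !addrA.
by rewrite [LHS](ACl (4*6*1*3*2*5))%AC.
Qed.

(** Isolating [x] makes two such relations with the same [y] and [z] comparable. *)
Lemma anticomm_mulr (F : fieldType) (V : lmodType F) (a b : F) (x y z : V) :
  x + y = a *: (z + x) - b *: z -> (1 - a) *: x = (a - b) *: z - y.
Proof.
move=> e; rewrite !scalerBl scale1r -[x in x - _](addrK y) e scalerDr.
by rewrite [LHS](ACl ((2*5)*1*3*4))%AC /= subrr add0r.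
Qed.

Section Commutation.

Variables (F : fieldType) (alpha : F) (V : lmodType F) (p q r : {linear V -> V}).
Hypotheses (h : 2%:R * alpha != 3%:R).
Hypotheses (pp : idempotent_fun p) (qq : idempotent_fun q).
Hypotheses (rr : idempotent_fun r) (pqr : p \+ q \+ r =1 alpha \*: idfun).

Lemma idempotent_comm v : p (q v) = q (p v).
Proof.
have ac := idempotent_anticommutator pp qq rr pqr.
have pE w : p (p w) = p w := pp w.
have a1 : 1 - (2%:R * alpha - 2%:R) != 0.
  by rewrite opprB addrA -(natrD _ 1 2) subr_eq0 eq_sym.
apply: (scalerI a1).
(* Both relations have [z = p v] and [y = p (q (p v))]; [x] is [q (p v)] in one and [p (q v)] in the
   other. *)
have := congr1 p (ac v); have := ac (p v).
rewrite (linearB p) !(linearZ_LR p) !(linearD p) !pE addrC.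
by move=> /anticomm_mulr -> /anticomm_mulr ->.
Qed.

Lemma idempotent_sum_eq0 v :
  alpha \notin [:: 0; 1; 2%:R; 3%:R] -> p v = 0.
Proof.
rewrite !inE !negb_or => /and4P[_ a1 a2 a3].
have ac := idempotent_anticommutator pp qq rr pqr.
have pE w : p (p w) = p w := pp w.
have qE w : q (q w) = q w := qq w.
(* Used with [t = p (q v)] and [u] equal to [p v] or [q v]. Only [2 - alpha] is cancelled, never
   [2], so characteristic 2 is covered. *)
have half u t :
    t + t = (2%:R * alpha - 2%:R) *: (u + t) - (alpha ^+ 2 - alpha) *: u ->
  t + t = (alpha - 1) *: u.
  move=> /anticomm_mulr e.
  have a2' : 2%:R - alpha != 0 by rewrite subr_eq0 eq_sym.
  apply: (scalerI a2'); rewrite scalerA.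
  have -> : (2%:R - alpha) * (alpha - 1)
    = 2%:R * alpha - 2%:R - (alpha ^+ 2 - alpha) by ring.
  rewrite -[RHS](subrK t) -e -mulr2n -scaler_nat scalerA -[X in _ = _ + X]scale1r -scalerDl.
  by congr (_ *: _); ring.
have := ac (p v); rewrite pE -idempotent_comm pE => /half tp.
have := ac (q v).
rewrite -(idempotent_comm (q v)) qE [p _ + q v]addrC => /half tq.
have a10 : alpha - 1 != 0 by rewrite subr_eq0.
have pq : p v = q v by apply: (scalerI a10); rewrite -tp.
have a30 : alpha - 3%:R != 0 by rewrite subr_eq0.
apply: (scalerI a30); rewrite scaler0.
(* As [q v = p v], also [p (q v) = p v], so [tp] reads [2 p v = (alpha - 1) p v]. *)
have -> : alpha - 3%:R = alpha - 1 - 2%:R by ring.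
by rewrite scalerBl -tp -pq pE scaler_nat mulr2n subrr.
Qed.

End Commutation.

Theorem proposition5 (F : fieldType) (alpha : F)
  (halpha : alpha \notin [:: 0; 1; 2%:R; 3%:R])
  (h2alpha : 2%:R * alpha != 3%:R)
  (V : lmodType F) (hV : exists v : V, v != 0) :
  ~ exists p q r : {linear V -> V},
      [/\ idempotent_fun p, idempotent_fun q, idempotent_fun r
        & p \+ q \+ r =1 alpha \*: idfun].
Proof.
case=> [p [q [r [pp qq rr pqr]]]]; case: hV => v /eqP; apply.
have a0 : alpha != 0 by move: halpha; rewrite !inE negb_or => /andP[].
apply: (scalerI a0); rewrite scaler0 -[LHS]/((alpha \*: idfun) v) -pqr /=.
(* The sum is symmetric, so [q] and [r] can each take the place of [p]. *)
have qpr : q \+ p \+ r =1 alpha \*: idfun.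
  by move=> w; rewrite -pqr /= [q w + _]addrC.
have rqp : r \+ q \+ p =1 alpha \*: idfun.
  by move=> w; rewrite -pqr /= addrC [r w + _]addrC addrA.
rewrite (idempotent_sum_eq0 h2alpha pp qq rr pqr) //.
rewrite (idempotent_sum_eq0 h2alpha qq pp rr qpr) //.
by rewrite (idempotent_sum_eq0 h2alpha rr qq pp rqp) // !addr0.
Qed.
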